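(* Let $(\mathcal{X},\mathfrak{P}_\theta,\theta)$ be a generalized $\theta$-parametric metric space, let $a\in\mathcal{X}$, $r,t>0$, and let $\mathscr{B}[a,r,t]=\{y\in\mathcal{X}:\mathfrak{P}_\theta(a,y,t)\le r\}$ be the closed ball. Suppose that for every sequence $(s_n)$ in $\mathcal{X}$ and every $s\in\mathcal{X}$, $$\lim_{n\to\infty}\mathfrak{P}_\theta(s_n,s,p)=0\ \ \forall p>0\ \Longrightarrow\ \mathfrak{P}_\theta(s,y,p)\le\limsup_{n\to\infty}\mathfrak{P}_\theta(s_n,y,p)\ \ \forall y\in\mathcal{X},\ \forall p>0.$$ Then $\mathscr{B}[a,r,t]$ is a closed set in $(\mathcal{X},\mathfrak{P}_\theta,\theta)$.
   Context: A $\mathcal{B}$-action is a map $\theta:[0,\infty)^2\to[0,\infty)$, continuous in each variable, with image $\mathrm{Im}(\theta)$, such that: ($\mathcal{B}1$) $\theta(0,0)=0$ and $\theta(x,y)=\theta(y,x)$ for all $x,y\ge0$; ($\mathcal{B}2$) $\theta(x,y)<\theta(u,v)$ whenever either $x<u,\ y\le v$ or $x\le u,\ y<v$; ($\mathcal{B}3$) for each $r\in\mathrm{Im}(\theta)$ and each $x\in[0,r]$ there is $y\in[0,r]$ with $\theta(x,y)=r$; ($\mathcal{B}4$) $\theta(y,0)\le y$ for all $y>0$. $\mathfrak{F}$ is the set of functions $f:(0,\infty)\to\mathbb{R}$ such that $f$ is non-decreasing and, for every sequence $(\varepsilon_n)$ in $(0,\infty)$, $\lim\varepsilon_n=0$ if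 and only if $\lim f(\varepsilon_n)=-\infty$. Let $\mathcal{X}$ be a nonempty set and $\theta$ a $\mathcal{B}$-action. A generalized $\theta$-parametric metric on $\mathcal{X}$ is a function $\mathfrak{P}_\theta:\mathcal{X}\times\mathcal{X}\times(0,\infty)\to[0,\infty)$ that is symmetric ($\mathfrak{P}_\theta(x,y,p)=\mathfrak{P}_\theta(y,x,p)$) and satisfies: ($\mathfrak{P}_\theta1$) $\mathfrak{P}_\theta(x,y,p)=0$ for all $p>0$ if and only if $x=y$; ($\mathfrak{P}_\theta2$) there exists $(f,\alpha)\in\mathfrak{F}\times[0,\infty)$ such that for all $s,p>0$ and $x,y,z\in\mathcal{X}$: if $\mathfrak{P}_\theta(x,y,r)>0$ for all $r>0$, then $f(\mathfrak{P}_\theta(x,y,s+p))\le f(\theta(\mathfrak{P}_\theta(x,z,s),\mathfrak{P}_\theta(z,y,p)))+\alpha$ (with the convention $f(0)=-\infty$). Then $(\mathcal{X},\mathfrak{P}_\theta,\theta)$ is called a generalized $\theta$-parametric metric space. A sequence $(s_n)$ converges to $s$ if $\lim_n\mathfrak{P}_\theta(s_n,s,p)=0$ for every $p>0$. A subset $F\subseteq\mathcal{X}$ is a closed set if no sequence in $F$ converges to a point of $\mathcal{X}\setminus F$. The $\limsup$ is taken in $[0,\infty]$. *)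

(* Defs.v *)
From HB Require Import structures.
From mathcomp Require Import all_boot all_order all_algebra.
From mathcomp Require Import all_classical all_reals all_analysis.

Set Implicit Arguments.
Unset Strict Implicit.
Unset Printing Implicit Defensive.

Import Order.TTheory GRing.Theory Num.Theory.
Import numFieldNormedType.Exports.

Local Open Scope classical_set_scope.
Local Open Scope ring_scope.

(* Functions whose domain is [0, +oo[^2, ]0, +oo[, or X * X * ]0, +oo[ are
   total functions on the ambient types; every axiom below only constrains
   them on their actual domain. *)

Definition B_image (R : realType) (theta : R -> R -> R) : set R :=
  [set theta x y | x in [set x : R | 0 <= x] & y in [set y : R | 0 <= y]].

Record B_action (R : realType) (theta : R -> R -> R) : Prop := {
  B_ge0 : forall x y : R, 0 <= x -> 0 <= y -> 0 <= theta x y;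
  B_continuous_r : forall x : R, 0 <= x ->
    {within [set y : R | 0 <= y], continuous (fun y => theta x y)};
  B_continuous_l : forall y : R, 0 <= y ->
    {within [set x : R | 0 <= x], continuous (fun x => theta x y)};
  B1_zero : theta 0 0 = 0;
  B1_sym : forall x y : R, 0 <= x -> 0 <= y -> theta x y = theta y x;
  B2 : forall x y u v : R, 0 <= x -> 0 <= y -> 0 <= u -> 0 <= v ->
    (x < u /\ y <= v) \/ (x <= u /\ y < v) -> theta x y < theta u v;
  B3 : forall r x : R, B_image theta r -> 0 <= x <= r ->
    exists y, 0 <= y <= r /\ theta x y = r;
  B4 : forall y : R, 0 < y -> theta y 0 <= y
}.

Record F_class (R : realType) (f : R -> R) : Prop := {
  F_nondecreasing : forall x y : R, 0 < x -> 0 < y -> x <= y -> f x <= f y;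
  F_limit : forall eps : nat -> R, (forall n, 0 < eps n) ->
    (eps n @[n --> \oo] --> (0 : R)) <-> (f (eps n) @[n --> \oo] --> -oo)
}.

(* f extended to [0, +oo[ by the convention f(0) = -oo. *)
Definition F_ext (R : realType) (f : R -> R) (x : R) : \bar R :=
  if x == 0 then (-oo)%E else (f x)%:E.

Record gen_parametric_metric (R : realType) (X : Type)
    (theta : R -> R -> R) (P : X -> X -> R -> R) : Prop := {
  P_ge0 : forall (x y : X) (p : R), 0 < p -> 0 <= P x y p;
  P_sym : forall (x y : X) (p : R), 0 < p -> P x y p = P y x p;
  P1 : forall x y : X, (forall p : R, 0 < p -> P x y p = 0) <-> x = y;
  P2 : exists (f : R -> R) (alpha : R), F_class f /\ 0 <= alpha /\
    forall (s p : R) (x y z : X), 0 < s -> 0 < p ->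
      (forall r : R, 0 < r -> 0 < P x y r) ->
      (F_ext f (P x y (s + p)%R) <=
         F_ext f (theta (P x z s) (P z y p)) + alpha%:E)%E
}.

Record gen_parametric_metric_space (R : realType) (X : Type)
    (theta : R -> R -> R) (P : X -> X -> R -> R) : Prop := {
  space_nonempty : [set: X] !=set0;
  space_action : B_action theta;
  space_metric : gen_parametric_metric theta P
}.

Definition P_converges (R : realType) (X : Type) (P : X -> X -> R -> R)
    (s_ : nat -> X) (s : X) : Prop :=
  forall p : R, 0 < p -> P (s_ n) s p @[n --> \oo] --> (0 : R).

Definition P_closed (R : realType) (X : Type) (P : X -> X -> R -> R)
    (F : set X) : Prop :=
  ~ exists (s_ : nat -> X) (s : X),
      [/\ forall n, F (s_ n), (~` F) s & P_converges P s_ s].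

Definition closed_P_ball (R : realType) (X : Type) (P : X -> X -> R -> R)
    (a : X) (r t : R) : set X :=
  [set y | P a y t <= r].

(* Main.v *)
Require Import Defs.
From HB Require Import structures.
From mathcomp Require Import all_boot all_order all_algebra.
From mathcomp Require Import all_classical all_reals all_analysis.

(** The limsup hypothesis is sequential lower semicontinuity of each map
    [P _ y p] (passing to a subsequence turns the limsup into a liminf), and
    sublevel sets of such maps are sequentially closed: for [s_ n] in the ball
    converging to [s], symmetry gives [P (s_ n) a t <= r], so the limsup is at
    most [r], and it dominates [P s a t = P a s t]. *)

Set Implicit Arguments.
Unset Strict Implicit.
Unset Printing Implicit Defensive.

Import Order.TTheory GRing.Theory Num.Theory.
Import numFieldNormedType.Exports.

Local Open Scope classical_set_scope.
Local Open Scope ring_scope.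

Theorem proposition3p27 (R : realType) (X : Type)
    (theta : R -> R -> R) (P : X -> X -> R -> R)
    (hP : gen_parametric_metric_space theta P)
    (a : X) (r t : R) (hr : 0 < r) (ht : 0 < t)
    (hlim : forall (s_ : nat -> X) (s : X),
      (forall p : R, 0 < p -> P (s_ n) s p @[n --> \oo] --> (0 : R)) ->
      forall (y : X) (p : R), 0 < p ->
        ((P s y p)%:E <= limn_esup (fun n => (P (s_ n) y p)%:E))%E) :
  P_closed P (closed_P_ball P a r t).
Proof.
move=> [s_ [s [s_ball /= s_out s_cvg]]]; apply: s_out.
have [_ _ metricP] := hP.
rewrite /closed_P_ball /= (P_sym metricP _ _ ht) -lee_fin.
apply: le_trans (hlim s_ s s_cvg a t ht) _.
rewrite limn_esup_lim; apply: lime_le; first exact: is_cvg_esups.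
apply: nearW => n; apply: ge_ereal_sup => _ [k _ <-].
by rewrite lee_fin (P_sym metricP _ _ ht); exact: s_ball.
Qed.
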